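(* (a) For every integer $k\ge 0$ and every real $r\ge 0$, there exist $L,C$ such that if a graph $G$ admits a tree-decomposition $(T,(B_t:t\in V(T)))$ such that for each $t\in V(T)$, $B_t$ is the union of at most $k$ sets each with diameter at most $r$ in $G$, then $G$ admits an $(L,C)$-quasi-isometry to a graph with pseudo-tree-width at most $k$. (b) Conversely, for every integer $k\ge 0$ and all $L,C\ge 1$, if a graph $G$ admits an $(L,C)$-quasi-isometry to a graph with pseudo-tree-width at most $k$, then $G$ admits a tree-decomposition $(T,(B_t:t\in V(T)))$ such that for each $t\in V(T)$, $B_t$ is the union of at most $k$ sets each of diameter at most $2L(L+C)+C$ in $G$.
   Context: Graphs may be infinite, and need not be connected. $\dist_G(u,v)$ is the number of edges in a shortest path of $G$ between $u,v$ ($\infty$ if there is none). The diameter of $X\subseteq V(G)$ in $G$ is the maximum of $\dist_G(u,v)$ over all $u,v\in X$ (distances are measured in $G$, not in $G[X]$). For $L,C\ge 0$, a map $\phi:V(G)\to V(H)$ is an $(L,C)$-quasi-isometry from $G$ to $H$ if: (i) for all $u,v\in V(G)$, if $\dist_G(u,v)$ is finite then $\dist_H(\phi(u),\phi(v))\le L\dist_G(u,v)+C$; (ii) for all $u,v\in V(G)$, if $\dist_H(\phi(u),\phi(v))$ is finite then $\dist_G(u,v)\le L\dist_H(\phi(u),\phi(v))+C$; (iii) for every $y\in V(H)$ there exists $v\in V(G)$ with $\dist_H(\phi(v),y)\le C$. ''$G$ admits an $(L,C)$-quasi-isometry to $H$'' means such a $\phi$ exists. A tree-decomposition of $G$ is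 a pair $(T,(B_t:t\in V(T)))$ where $T$ is a (possibly infinite) tree and each $B_t\subseteq V(G)$, such that $G$ is the union of the graphs $G[B_t]$ $(t\in V(T))$ and $B_{t_1}\cap B_{t_3}\subseteq B_{t_2}$ whenever $t_2$ lies on the path of $T$ between $t_1,t_3$. A pseudo-tree-decomposition of $G$ is a pair $(T,(B_t:t\in V(T)))$ where $T$ is a (possibly infinite) tree and each $B_t\subseteq V(G)$, such that: $V(G)=\bigcup_{t\in V(T)}B_t$; for every edge $uv$ of $G$, either there exists $t\in V(T)$ with $u,v\in B_t$, or there is an edge $st\in E(T)$ with $B_s\setminus B_t=\{u\}$ and $B_t\setminus B_s=\{v\}$; and $B_{t_1}\cap B_{t_3}\subseteq B_{t_2}$ whenever $t_2$ lies on the path of $T$ between $t_1,t_3$. Its width is the maximum of $|B_t|$ over $t\in V(T)$ (with no $-1$), or $\infty$ if there is no finite maximum; the pseudo-tree-width of $G$ is the minimum width of a pseudo-tree-decomposition of $G$. *)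

(* Defs.v *)
From HB Require Import structures.
From mathcomp Require Import all_boot all_order all_algebra.
From mathcomp Require Import boolp classical_sets functions cardinality.
From mathcomp Require Import reals constructive_ereal ereal counting_measure.

Set Implicit Arguments.
Unset Strict Implicit.
Unset Printing Implicit Defensive.

Import Order.TTheory GRing.Theory Num.Theory.
Local Open Scope classical_set_scope.
Local Open Scope ring_scope.

(* Possibly infinite, possibly empty simple graphs. Taking the vertices in a
   [choiceType] and a boolean adjacency relation is no restriction: classically
   every type is a [choiceType] and every relation is boolean. *)
Record sgraph := SGraph {
  vertex :> choiceType ;
  adj : rel vertex ;
  adj_sym : symmetric adj ;
  adj_irr : irreflexive adj }.

(* [u :: p] is the vertex sequence of a path, which thus has [size p] edges. *)
Definition is_path (G : sgraph) (u v : G) (p : seq G) : Prop :=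
  [/\ path (@adj G) u p, last u p = v & uniq (u :: p)].

(* [+oo] when there is no path, the infimum of the empty set being [+oo]. *)
Definition dist (R : realType) (G : sgraph) (u v : G) : \bar R :=
  ereal_inf [set (size p)%:R%:E | p in [set p | is_path u v p]].

(* The empty set has diameter [-oo], hence diameter at most every real. *)
Definition diam (R : realType) (G : sgraph) (X : set G) : \bar R :=
  ereal_sup [set d | exists u v, [/\ X u, X v & d = dist R u v]].

Definition quasi_isometry (R : realType) (L C : R) (G H : sgraph)
    (phi : G -> H) : Prop :=
  [/\ forall u v : G, (dist R u v < +oo)%E ->
        (dist R (phi u) (phi v) <= L%:E * dist R u v + C%:E)%E,
      forall u v : G, (dist R (phi u) (phi v) < +oo)%E ->
        (dist R u v <= L%:E * dist R (phi u) (phi v) + C%:E)%E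
    & forall y : H, exists v : G, (dist R (phi v) y <= C%:E)%E].

Definition is_tree (T : sgraph) : Prop :=
  [/\ exists t : T, True,
      forall s t : T, exists p, is_path s t p
    & forall c : seq T, (2 < size c)%N -> ~ ucycle (@adj T) c].

Definition path_convex (G T : sgraph) (B : T -> set G) : Prop :=
  forall (t1 t2 t3 : T) (p : seq T),
    is_path t1 t3 p -> t2 \in t1 :: p -> B t1 `&` B t3 `<=` B t2.

Definition tree_decomposition (G T : sgraph) (B : T -> set G) : Prop :=
  [/\ is_tree T,
      forall v : G, exists t, B t v,
      forall u v : G, adj u v -> exists t, B t u /\ B t v
    & path_convex B].

Definition pseudo_tree_decomposition (G T : sgraph) (B : T -> set G) : Prop :=
  [/\ is_tree T,
      forall v : G, exists t, B t v,
      forall u v : G, adj u v ->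
        (exists t, B t u /\ B t v) \/
        (exists s t, [/\ adj s t, B s `\` B t = [set u]
                       & B t `\` B s = [set v]])
    & path_convex B].

(* [counting X] is the number of elements of [X], and [+oo] if [X] is infinite. *)
Definition width (R : realType) (G T : sgraph) (B : T -> set G) : \bar R :=
  ereal_sup [set counting (B t) | t in [set: T]].

Definition pseudo_tree_width (R : realType) (G : sgraph) : \bar R :=
  ereal_inf [set w | exists (T : sgraph) (B : T -> set G),
                       pseudo_tree_decomposition B /\ w = width R B].

Definition union_of_bounded (R : realType) (G : sgraph) (k : nat) (d : R)
    (X : set G) : Prop :=
  exists F : set (set G),
    [/\ (F #<= `I_k)%card,
        forall Y, F Y -> (diam R Y <= d%:E)%E
      & X = \bigcup_(Y in F) Y].

Definition has_bounded_tree_decomposition (R : realType) (G : sgraph)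
    (k : nat) (d : R) : Prop :=
  exists (T : sgraph) (B : T -> set G),
    tree_decomposition B /\ forall t, union_of_bounded k d (B t).

Definition quasi_isometric_to_ptw_le (R : realType) (L C : R) (G : sgraph)
    (k : nat) : Prop :=
  exists (H : sgraph) (phi : G -> H),
    quasi_isometry L C phi /\ (pseudo_tree_width R H <= k%:R%:E)%E.

(* Main.v *)
(* For (b), replace each vertex y of a bag of the pseudo-tree-decomposition of H
   by the set of all v such that phi(v) is at distance at most L + C from y.

   For (a), root T. Every vertex v has a highest node top(v), which measures its
   age, and every bag falls into clusters, its components at scale r, whose
   diameter is at most D = 2kr. Going down from the root, some vertices carry a
   label. A cluster of B_t is triggered if it contains a vertex z such that no
   labelled vertex at least as old as z is at distance at most D from z; then all
   vertices of the cluster receive a new common label. Elsewhere the labels are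
   inherited. Labelled vertices of a bag at distance at most r have the same
   label, so a bag sees at most k labels, and these are the bags of H. Every
   vertex stays close to a labelled vertex at least as old as itself. The point
   is that the vertices of the bag B_s, s = top(v), see at most 2k labels on any
   branch below s: whenever a cluster meeting B_s is relabelled, it contains an
   unlabelled vertex of B_s, and what remains of the part of diameter at most r
   containing this vertex is labelled from then on; there are k such parts.
   So all labels seen near v are at bounded distance in H. To keep the width k,
   each new label is joined to a single label of the parent bag, and pseudo-edges
   exchange the dying labels for new ones, one at a time. *)
Require Import Defs.
From mathcomp Require Import all_boot all_order all_algebra.
From mathcomp Require Import boolp classical_sets functions cardinality.
From mathcomp Require Import reals constructive_ereal ereal counting_measure.
From mathcomp Require Import zify.

Set Implicit Arguments.
Unset Strict Implicit.
Unset Printing Implicit Defensive.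

Import Order.TTheory GRing.Theory Num.Theory.
Local Open Scope classical_set_scope.
Local Open Scope nat_scope.

(** * Bounded distance through walks *)

(** Arbitrary walks make concatenation immediate; [dist_le_simple] goes back to simple paths. *)
Definition dist_le (G : sgraph) (n : nat) (u v : G) : Prop :=
  exists p : seq G, [/\ path (@adj G) u p, last u p = v & size p <= n].

Lemma dist_le_refl (G : sgraph) (u : G) n : dist_le n u u.
Proof. by exists [::]. Qed.

Lemma dist_le_adj (G : sgraph) (u v : G) : adj u v -> dist_le 1 u v.
Proof. by move=> uv; exists [:: v] => /=; rewrite uv. Qed.

Lemma dist_le_le (G : sgraph) (u v : G) m n : m <= n -> dist_le m u v -> dist_le n u v.
Proof. by move=> mn [p [? ? s]]; exists p; split=> //; exact: leq_trans mn. Qed.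

Lemma dist_le_trans (G : sgraph) (u v w : G) m n :
  dist_le m u v -> dist_le n v w -> dist_le (m + n) u w.
Proof.
move=> [p [pp lp sp]] [q [pq lq sq]]; exists (p ++ q).
by rewrite cat_path last_cat size_cat lp pp pq leq_add.
Qed.

Lemma dist_le_sym (G : sgraph) (u v : G) n : dist_le n u v -> dist_le n v u.
Proof.
move=> [p [pp <- sp]]; exists (rev (belast u p)); split.
- by rewrite rev_path (eq_path (e' := @adj G)) // => x y; rewrite /= adj_sym.
- by case: p {pp sp} => //= x p; rewrite rev_cons last_rcons.
- by rewrite size_rev size_belast.
Qed.

Lemma dist_le_simple (G : sgraph) (u v : G) n :
  dist_le n u v -> exists2 p, is_path u v p & size p <= n.
Proof.
move=> [p [pp <- sp]]; case/shortenP: pp => q pq uq sq.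
exists q; first by split.
by apply: leq_trans sp; apply: uniq_leq_size => //; move: uq => /= /andP[].
Qed.

Lemma dist_le_ind (G H : sgraph) (f : G -> H) c :
  (forall u v, adj u v -> dist_le c (f u) (f v)) ->
  forall n u v, dist_le n u v -> dist_le (n * c) (f u) (f v).
Proof.
move=> fc n u v [p [pp <- sp]].
apply: (@dist_le_le _ _ _ (size p * c)); first by rewrite leq_mul2r sp orbT.
elim: p u pp {sp} => /= [|x p IH] u; first by exists [::].
move=> /andP[ux px]; rewrite mulSn.
exact: dist_le_trans (fc _ _ ux) (IH _ px).
Qed.

(** * Chains of steps inside a set *)

(** Common form of three notions: connected sets of nodes in a tree, clusters at scale [r] in a bag,
    and sequences of labels with bounded steps. *)
Inductive chain (X : Type) (P : X -> Prop) (A : X -> X -> Prop) : X -> X -> Prop :=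
| chain0 x : P x -> chain P A x x
| chainS x y z : P x -> A x y -> chain P A y z -> chain P A x z.

Section Chain.
Variables (X : Type) (P : X -> Prop) (A : X -> X -> Prop).

Lemma chain_left x y : chain P A x y -> P x.
Proof. by case. Qed.

Lemma chain_right x y : chain P A x y -> P y.
Proof. by elim. Qed.

Lemma chain_trans x y z : chain P A x y -> chain P A y z -> chain P A x z.
Proof. by elim=> // {x y} x y w Px xy _ IH /IH; exact: chainS. Qed.

Lemma chain1 x y : P x -> P y -> A x y -> chain P A x y.
Proof. by move=> Px Py xy; apply: chainS xy _ => //; exact: chain0. Qed.

Lemma chain_sym x y : (forall x y, A x y -> A y x) -> chain P A x y -> chain P A y x.
Proof.
move=> symA; elim=> [{}x|{}x {}y z Px xy yz IH]; first exact: chain0.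
apply: chain_trans IH _; apply: chain1 (symA _ _ xy) => //.
exact: chain_left yz.
Qed.

Lemma chain_sub (P' : X -> Prop) x y :
  (forall x, P x -> P' x) -> chain P A x y -> chain P' A x y.
Proof.
move=> PP'; elim=> [z /PP'|{}x {}y z /PP' Px xy _]; first exact: chain0.
exact: chainS.
Qed.

Lemma chain_last_exit (Q : X -> Prop) x y : chain P A x y ->
  chain (fun z => P z /\ ~ Q z) A x y \/
  exists z, [/\ P z, Q z &
    z = y \/ exists2 w, A z w & chain (fun z => P z /\ ~ Q z) A w y].
Proof.
elim=> [z Pz|{}x {}y z Px xy _ [IH|IH]]; last by right.
- have [Qz|nQz] := pselect (Q z); [right; exists z; split=> //; by left|].
  by left; exact: chain0.
- have [Qx|nQx] := pselect (Q x).
    by right; exists x; split=> //; right; exists y.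
  by left; apply: chainS xy IH.
Qed.

End Chain.

(* Jumping from the first vertex of each class directly to the last one leaves at
   most two steps per class. *)
Lemma chain_tagged (G : sgraph) d (J : eqType) (tag : G -> J -> Prop)
    (js : seq J) (P : G -> Prop) (x y : G) :
  (forall x, P x -> exists2 j, j \in js & tag x j) ->
  (forall x y j, P x -> P y -> tag x j -> tag y j -> dist_le d x y) ->
  chain P (@dist_le G d) x y -> dist_le (2 * size js * d) x y.
Proof.
have [n] := ubnP (size js); elim: n js P x y => // n IH js P x y sn tagP closeP xy.
have [j jjs xj] := tagP x (chain_left xy).
have jpos : 0 < size js by case: (js) jjs.
have [xw|[z [Pz zj]]] := chain_last_exit (tag^~ j) xy; first by have [_] := chain_left xw.
have xz := closeP _ _ _ (chain_left xy) Pz xj zj.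
case=> [<-|[w zw wy]].
  by apply: dist_le_le xz; rewrite leq_pmull // muln_gt0.
have lt : size [seq i <- js | i != j] < size js.
  rewrite size_filter -(count_predC (pred1 j)) -[X in X < _]add0n.
  by rewrite ltn_add2r -has_count; apply/hasP; exists j => /=.
(* The tail after the last element tagged [j] avoids [j], so the remaining tags suffice for it. *)
have := IH [seq i <- js | i != j] (fun z => P z /\ ~ tag z j) w y.
have lt' : size [seq i <- js | i != j] < n by exact: leq_trans lt _.
move=> /(_ lt') H.
have {}H : dist_le (2 * size [seq i <- js | i != j] * d) w y.
  apply: H wy => [t [Pt nt]|t t' i [Pt _] [Pt' _]]; last exact: closeP.
  have [i ijs ti] := tagP t Pt; exists i => //.
  by rewrite mem_filter ijs andbT; apply: contra_notN nt => /eqP <-.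
apply: dist_le_le (dist_le_trans (dist_le_trans xz zw) H).
by nia.
Qed.

(** * Chains as paths, and uniqueness of paths in trees *)

Lemma path_chain (G : sgraph) (S : G -> Prop) (u : G) p :
  path (@adj G) u p -> (forall z, z \in u :: p -> S z) ->
  chain S (@adj G) u (last u p).
Proof.
elim: p u => [|x p IH] u /=; first by move=> _ Su; apply/chain0/Su; rewrite inE.
move=> /andP[ux px] Sp; apply: (chainS _ ux); first by apply: Sp; rewrite inE eqxx.
by apply: IH => // z zp; apply: Sp; rewrite inE zp orbT.
Qed.

Lemma chain_path (G : sgraph) (S : G -> Prop) (u v : G) :
  chain S (@adj G) u v -> exists2 p, is_path u v p & forall z, z \in u :: p -> S z.
Proof.
move=> uv.
have [p [pp <- Sp]] : exists p, [/\ path (@adj G) u p, last u p = v &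
    forall z, z \in u :: p -> S z].
  elim: uv => [x Sx|x y z Sx xy _ [p [pp lp Sp]]].
    by exists [::]; split=> // z; rewrite inE => /eqP ->.
  exists (y :: p); split=> //=; first by rewrite xy.
  by move=> w; rewrite inE => /predU1P[->//|/Sp].
case/shortenP: pp => q pq uq sq; exists q; first by split.
move=> z; rewrite inE => /predU1P[->|/sq zp]; apply: Sp; first by rewrite inE eqxx.
by rewrite inE zp orbT.
Qed.

(** After their common prefix, two different paths leave a vertex through different neighbours and
    meet again, which closes a cycle. *)
Lemma tree_path_unique (T : sgraph) (u v : T) p q :
  is_tree T -> is_path u v p -> is_path u v q -> p = q.
Proof.
move=> [_ _ acyc]; elim: p u q => [|a p IH] u [|b q].
- by [].
- by move=> [_ /= <- _] [_ /= lq /andP[]]; rewrite -[X in X \notin _]lq mem_last.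
- move=> [_ /= lq /andP[]] + _ [_ /= uv _]; rewrite -uv in lq.
  by rewrite -[X in X \notin _]lq mem_last.
move=> [/= /andP[ua pp] lp up] [/= /andP[ub pq] lq uq].
have [eab|nab] := eqVneq a b.
  subst b; congr (_ :: _); apply: (IH a).
    by split=> //; move: up => /= /andP[].
  by split=> //; move: uq => /= /andP[].
exfalso.
have hasq : has (mem (b :: q)) (a :: p).
  by apply/hasP; exists v; rewrite -?lp ?mem_last //= lp -lq mem_last.
(* [z] is the first vertex of one path on the other, so the segments [p1] and [q1] before it are
   disjoint. *)
have [z [p1 [p2 [ep zq p1q]]]] : exists z p1 p2,
    [/\ a :: p = p1 ++ z :: p2, z \in b :: q & ~~ has (mem (b :: q)) p1].
  case: (split_find hasq) => z p1 p2 zq p1q.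
  by exists z, p1, p2; rewrite cat_rcons.
have [q1 [q2 eq]] : exists q1 q2, b :: q = q1 ++ z :: q2.
  by case/splitPr: zq => q1 q2; exists q1, q2.
have {pp ua} : path (@adj T) u (a :: p) by rewrite /= ua.
have {pq ub} : path (@adj T) u (b :: q) by rewrite /= ub.
have {}up : uniq (u :: a :: p) by [].
have {}uq : uniq (u :: b :: q) by [].
rewrite ep eq in up uq p1q *.
rewrite !cat_path /= => /and3P[uq1 q1z _] /and3P[up1 p1z _].
have zc : path (@adj T) z (rcons (rev q1) u).
  have -> : rcons (rev q1) u = rev (belast u (rcons q1 z)).
    by rewrite belast_rcons rev_cons.
  rewrite -{1}(last_rcons u q1 z) rev_path (eq_path (e' := @adj T)).
    by rewrite rcons_path uq1.
  by move=> x y; rewrite /= adj_sym.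
apply: (acyc (u :: p1 ++ z :: rev q1)).
  (* If [p1] and [q1] were both empty, [a] and [b] would both be [z]; hence the cycle has at least
     three vertices. *)
  rewrite /= size_cat /= size_rev.
  case: p1 q1 ep eq {up uq p1q uq1 q1z up1 p1z zc} => [|? ?] [|? ?] /=; try lia.
  by move=> [az _] [bz _]; rewrite az bz eqxx in nab.
rewrite /ucycle; apply/andP; split.
  by rewrite /cycle -cats1 -catA cat_path /= up1 p1z /= cats1.
move: up; rewrite cons_uniq mem_cat inE !negb_or cat_uniq /=.
rewrite !negb_or => /andP[/and3P[up1' uz _] /and3P[p1u /andP[zp1 _] _]].
move: uq; rewrite cons_uniq mem_cat !negb_or cat_uniq /=.
rewrite !negb_or => /andP[/andP[uq1' _] /and3P[q1u /andP[zq1 _] _]].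
rewrite cat_uniq mem_cat inE /= !mem_rev rev_uniq !negb_or up1' uz uq1' p1u q1u zp1 zq1 /= andbT.
apply/hasPn => x; rewrite mem_rev => xq1; apply/negP => xp1.
by move/hasPn: p1q => /(_ x xp1); rewrite /= mem_cat xq1.
Qed.

(** * Rooted trees *)

Lemma is_path_behead (G : sgraph) (u v w : G) p : is_path u w (v :: p) -> is_path v w p.
Proof. by move=> [/= /andP[_ ?] ? /andP[_ ?]]. Qed.

Lemma path_convexP (G T : sgraph) (B : T -> set G) : is_tree T ->
  (forall v s t, B s v -> B t v -> chain (B^~ v) (@adj T) s t) -> path_convex B.
Proof.
move=> treeT cB t1 t2 t3 p pp t2p v [B1 B3].
have [q qp qB] := chain_path (cB _ _ _ B1 B3).
by apply: qB; rewrite -(tree_path_unique treeT pp qp).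
Qed.

Lemma path_convex_chain (G T : sgraph) (B : T -> set G) v s t : is_tree T ->
  path_convex B -> B s v -> B t v -> chain (B^~ v) (@adj T) s t.
Proof.
move=> [_ conT _] cB Bs Bt; have [p pp] := conT s t.
have [p1 p2 _] := pp; rewrite -p2.
by apply: path_chain p1 _ => z /(cB _ _ _ _ pp); apply.
Qed.

(** The value [par root] is left arbitrary; the height [h] supports induction towards the root. *)
Definition rooted (T : sgraph) (root : T) (par : T -> T) (h : T -> nat) : Prop :=
  [/\ h root = 0,
      forall t, t != root -> adj t (par t),
      forall t, t != root -> h t = (h (par t)).+1
    & forall s t, adj s t -> (s != root /\ par s = t) \/ (t != root /\ par t = s)].

(** The parent of [t] is the second vertex of the unique path from [t] to the root, and the height
    of [t] is the length of this path. *)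
Lemma tree_rooted (T : sgraph) : is_tree T -> exists root par h, @rooted T root par h.
Proof.
move=> treeT; have [[root _] conT _] := treeT.
have /choice [P PP] : forall t, exists p, is_path t root p by move=> t; exact: conT.
have uniqP t p : is_path t root p -> p = P t.
  by move=> tp; exact: tree_path_unique treeT tp (PP t).
exists root, (fun t => head t (P t)), (fun t => size (P t)).
have step t : t != root -> exists2 x, P t = x :: P x & adj t x.
  move=> tr; case E : (P t) => [|x p].
    by have [_ /= H _] := PP t; rewrite E /= in H; rewrite H eqxx in tr.
  have := PP t; rewrite E => tp; exists x; last by case: tp => /= /andP[].
  by congr (_ :: _); apply: uniqP; apply: is_path_behead tp.
split.
- by rewrite -(uniqP root [::]).
- by move=> t /step[x -> tx].
- by move=> t /step[x -> tx].
move=> s t st.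
have [tr|tnr] := eqVneq t root.
  left; subst t; have sr : s != root by apply: contraTneq st => ->; rewrite adj_irr.
  split=> //; rewrite -(uniqP s [:: root]) //; split=> //=; first by rewrite st.
  by rewrite inE sr.
(* Either the path from [t] avoids [s], and then it extends to the path from [s], or it meets [s],
   and then by uniqueness its first step goes to [s]. *)
have [sP|sP] := boolP (s \in P t); last first.
  left; have tsP : is_path s root (t :: P t).
    have [p1 p2 p3] := PP t; split=> //=; first by rewrite st p1.
    rewrite inE negb_or sP andbT; move: p3 => /= ->; rewrite andbT.
    by apply: contraTneq st => ->; rewrite adj_irr.
  split; last by rewrite -(uniqP _ _ tsP).
  apply: contraTneq sP => sr.
  by have [_ lt _] := PP t; have [x E _] := step t tnr; rewrite sr -{1}lt E /= mem_last.
right; split=> //.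
have : is_path t root (s :: P s).
  have [p1 p2 p3] := PP s; split=> //=; first by rewrite adj_sym st.
  rewrite inE negb_or; move: p3 => /= ->; rewrite andbT; apply/andP; split.
    by apply: contraTneq st => ->; rewrite adj_irr.
  have [q1 q2 q3] := PP t; case/splitPr: sP q1 q2 q3 => a b.
  rewrite cat_path last_cat /= => /and3P[_ _ sb] lb.
  rewrite mem_cat inE !negb_or => /andP[/and3P[_ _ tb]].
  rewrite cat_uniq /= => /and3P[_ _ usb].
  by rewrite -(uniqP s b).
by move/uniqP => <-.
Qed.

Section Rooted.
Variables (T : sgraph) (root : T) (par : T -> T) (h : T -> nat).
Hypothesis rT : rooted root par h.

Lemma rooted_ind (Q : T -> Prop) :
  (forall t, (t != root -> Q (par t)) -> Q t) -> forall t, Q t.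
Proof.
move=> IH t; have [n] := ubnP (h t); elim: n t => // n IHn t tn.
apply: IH => tr; apply: IHn; have [_ _ /(_ t tr) E _] := rT; by rewrite E in tn.
Qed.

(** On a cycle, both neighbours of a vertex of greatest height would be its parent. *)
Lemma rooted_is_tree : is_tree T.
Proof.
have [h0 adjp hp adjE] := rT.
have conR t : chain (fun=> True) (@adj T) t root.
  elim/rooted_ind: t => t IH; have [->|tr] := eqVneq t root; first exact: chain0.
  exact: chainS (adjp _ tr) (IH tr).
split; first by exists root.
  move=> s t.
  have [|p pp _] := @chain_path T (fun=> True) s t; last by exists p.
  apply: chain_trans (conR s) (chain_sym _ (conR t)).
  by move=> x y; rewrite adj_sym.
move=> c sc /andP[cyc uc].
have [x xc xmax] : exists2 x, x \in c & forall y, y \in c -> h y <= h x.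
  case: c sc {cyc uc} => // a c _.
  elim: c a => [|b c IH] a; first by exists a; rewrite ?inE // => y; rewrite inE => /eqP ->.
  have [x xc xmax] := IH b.
  have [ax|xa] := leqP (h a) (h x).
    exists x; first by rewrite inE xc orbT.
    by move=> y; rewrite inE => /predU1P[->//|/xmax].
  exists a; first by rewrite inE eqxx.
  by move=> y; rewrite inE => /predU1P[->//|/xmax/leq_trans]; apply; exact: ltnW.
have nbr y : y \in c -> adj x y -> par x = y.
  move=> yc /adjE[[] //|[yr xy]].
  by have := xmax y yc; rewrite (hp y yr) xy ltnn.
have [i c' rc] := rot_to xc.
rewrite -(rot_uniq i) rc in uc; rewrite -(rot_cycle i) rc in cyc.
rewrite -(size_rot i) rc in sc.
have memc y : y \in c' -> y \in c by move=> yc; rewrite -(mem_rot i) rc inE yc orbT.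
case: c' {rc} cyc uc sc memc => [|a c'] //; case/lastP: c' => [|c' b] // cyc uc _ memc.
move: cyc => /=; rewrite rcons_path last_rcons => /andP[xa /andP[_ bx]].
have ea : par x = a by apply: nbr => //; apply: memc; rewrite inE eqxx.
have eb : par x = b.
  by apply: nbr; [apply: memc; rewrite inE mem_rcons inE eqxx orbT|rewrite adj_sym].
by move: uc; rewrite -ea -eb /= mem_rcons inE eqxx andbF.
Qed.

Lemma chain_of_top (S : T -> Prop) top :
  (forall t, S t -> t = top \/ t != root /\ S (par t)) ->
  forall s t, S s -> S t -> chain S (@adj T) s t.
Proof.
have [_ adjp _ _] := rT; move=> Stop.
have down t : S t -> chain S (@adj T) t top.
  elim/rooted_ind: t => t IH St; have [<-|[tr Sp]] := Stop t St; first exact: chain0.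
  exact: chainS (adjp _ tr) (IH tr Sp).
move=> s t Ss St; apply: chain_trans (down s Ss) (chain_sym _ (down t St)).
by move=> x y; rewrite adj_sym.
Qed.

(** The top is a member of [S] of least height. *)
Lemma top_of_chain (S : T -> Prop) : (exists t, S t) ->
  (forall s t, S s -> S t -> chain S (@adj T) s t) ->
  exists top, S top /\ forall t, S t -> t = top \/ t != root /\ S (par t).
Proof.
have [_ _ hp adjE] := rT; move=> [t0 St0] cS.
have [top Stop hmin] : exists2 top, S top & forall t, S t -> h top <= h t.
  have [n] := ubnP (h t0); elim: n t0 St0 => // n IH t St tn.
  have [|nex] := pselect (exists2 u, S u & h u < h t).
    by move=> [u Su ut]; apply: (IH u Su); exact: leq_trans ut _.
  by exists t => // u Su; rewrite leqNgt; apply: contra_notN nex => ut; exists u.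
exists top; split=> // t St.
have [p [pp lp up] Sp] := chain_path (cS _ _ St Stop).
case: p pp lp up Sp => [|y p] /=; first by left.
move=> /andP[ty yp] lp /andP[tyn upy] Sp; right.
have Sy : S y by apply: Sp; rewrite !inE eqxx orbT.
have [[tr ey]|[yr yt]] := adjE _ _ ty; first by rewrite ey.
exfalso.
have hy : h t < h y by rewrite (hp y yr) yt.
(* A path that starts away from the root cannot turn back, so its heights only grow and it cannot
   end at [top]. *)
have : h y <= h (last y p).
  elim: p y t {ty lp Sp Sy hy St} yp upy yr yt tyn => [|z p IH] y t //=.
  move=> /andP[yz zp] /andP[yzp uzp] yr yt tyzp.
  have [[_ eyz]|[zr zy]] := adjE _ _ yz.
    by rewrite -eyz yt !inE eqxx orbT in tyzp.
  apply: leq_trans (IH z y zp uzp zr zy yzp).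
  by rewrite (hp z zr) zy.
by rewrite lp leqNgt (leq_ltn_trans (hmin t St) hy).
Qed.

End Rooted.

Section RootedTree.
Variables (X : choiceType) (root : X) (par : X -> X) (h : X -> nat).
Hypothesis h_root : h root = 0.
Hypothesis h_par : forall t, t != root -> h t = (h (par t)).+1.

Definition par_adj : rel X :=
  fun s t => (s != root) && (par s == t) || (t != root) && (par t == s).

Lemma par_adj_sym : symmetric par_adj.
Proof. by move=> s t; rewrite /par_adj orbC. Qed.

Lemma par_adj_irr : irreflexive par_adj.
Proof.
move=> s; rewrite /par_adj orbb; apply/negP => /andP[/h_par hs /eqP ps].
by move: hs; rewrite ps => /eqP; rewrite -{1}[h s]addn0 -addn1 eqn_add2l.
Qed.

Definition par_tree : sgraph := SGraph par_adj_sym par_adj_irr.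

Lemma par_tree_rooted : @rooted par_tree root par h.
Proof.
split=> // [t tr|s t /orP[/andP[? /eqP]|/andP[? /eqP]]]; last 2 first.
- by left.
- by right.
by rewrite /adj /= /par_adj tr eqxx.
Qed.

End RootedTree.

(** * Exchanging labels one at a time *)

Section Refinement.
Variables (T : sgraph) (root : T) (par : T -> T) (h : T -> nat).
Hypothesis rT : rooted root par h.
Variables (H : sgraph) (k : nat) (beta : T -> set H) (g : T -> H -> nat).
Variables (top : H -> T) (pr : H -> H).
Hypothesis g_lt : forall t Z, beta t Z -> g t Z < k.
Hypothesis g_inj : forall t Z Z', beta t Z -> beta t Z' -> g t Z = g t Z' -> Z = Z'.
Hypothesis top_beta : forall Z, beta (top Z) Z.
Hypothesis betaP : forall t Z, beta t Z -> t = top Z \/ t != root /\ beta (par t) Z.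
Hypothesis top_new : forall Z, top Z != root -> ~ beta (par (top Z)) Z.
Hypothesis adjP : forall Z Z' : H, adj Z Z' ->
  [\/ exists t, beta t Z /\ beta t Z',
      [/\ top Z != root, beta (par (top Z)) Z' & pr Z = Z'] |
      [/\ top Z' != root, beta (par (top Z')) Z & pr Z' = Z]].

(** These are the only edges of [H] whose ends may fail to share some [beta t]. *)
Let kid t P Z := [/\ top Z = t, t != root, pr Z = P, beta (par t) P & ~ beta t P].
Let rep t P := xget P [set Z | kid t P Z].
Let isrep t Z := kid t (pr Z) Z /\ rep t (pr Z) = Z.

(* Node [(t, i)], [i <= k], interpolates between [beta (par t)] and [beta t]; the
   nodes with [i > k] form a harmless pendant ray. A dying label [P] which is the
   parent of a new label is exchanged for [rep t P] between [i = g (par t) P] and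
   its successor; the other new labels are present from the start. *)
Let bag (x : T * nat) : set H := fun Z =>
  (beta x.1 Z /\ (isrep x.1 Z -> g (par x.1) (pr Z) < x.2)) \/
  ((exists Z', kid x.1 Z Z') /\ x.2 <= g (par x.1) Z).

(** The edge between [par t] and [t] becomes the path [(par t, k)], [(t, 0)], ..., [(t, k)], so each
    level of [T] accounts for [k.+1] units of the height [h']. *)
Let par' (x : T * nat) : T * nat := if x.2 is i.+1 then (x.1, i) else (par x.1, k).
Let h' (x : T * nat) := h x.1 * k.+1 + x.2.
Let root' : T * nat := (root, 0).

Let h'_root : h' root' = 0.
Proof. by rewrite /h' /=; have [-> _ _ _] := rT. Qed.

Let h'_par x : x != root' -> h' x = (h' (par' x)).+1.
Proof.
case: x => t [|i] /=; rewrite /h' /=; last by rewrite addnS.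
rewrite xpair_eqE andbT => tr; have [_ _ /(_ _ tr) -> _] := rT.
by rewrite mulSn; lia.
Qed.

Let T' := par_tree h'_par.
Let rT' : @rooted T' root' par' h' := par_tree_rooted h'_root h'_par.

Let repP t P Z : kid t P Z -> kid t P (rep t P) /\ isrep t (rep t P).
Proof.
move=> tPZ; have K : kid t P (rep t P) by apply: (@xgetPex _ P); exists Z.
by split=> //; split; have [_ _ -> _ _] := K.
Qed.

Let kid_beta t P Z : kid t P Z -> beta t Z.
Proof. by move=> [<- _ _ _ _]; exact: top_beta. Qed.

(** Every exchange at [t] happens at an index [g (par t) P < k], so all are over at [k]. *)
Let bag_full t Z : bag (t, k) Z <-> beta t Z.
Proof.
split=> [[[] //|[[Z' [_ tr _ bP _]] /=]]|bt].
  by rewrite leqNgt g_lt.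
by left; split=> //= -[[_ _ _ bP _] _]; exact: g_lt.
Qed.

Let bag_top Z : exists top', forall x, bag x Z -> x = top' \/ x != root' /\ bag (par' x) Z.
Proof.
(* A representative enters just after the exchange index of its parent label, any other label at
   [0]. *)
pose i0 := if `[< isrep (top Z) Z >] then (g (par (top Z)) (pr Z)).+1 else 0.
exists (top Z, i0) => -[t i] /= [[/= bt ri]|[[Z' K] /= ig]]; last first.
  have {}K : kid t Z Z' := K.
  right; have [_ tr _ bP _] := K; split; first by rewrite xpair_eqE (negPf tr).
  case: i ig => [|i] ig /=; first exact/bag_full.
  by right; split; [exists Z'|exact: ltnW].
have [tZ|[tr bp]] := betaP bt.
  subst t; rewrite /i0; case: asboolP => [rZ|nrZ].
    have := ri rZ; rewrite leq_eqVlt => /predU1P[->|]; first by left.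
    case: i {ri} => // i; rewrite ltnS => gi.
    right; split; first by rewrite xpair_eqE andbF.
    by left; split.
  case: i {ri} => [|i]; first by left.
  right; split; first by rewrite xpair_eqE andbF.
  by left; split.
right; split; first by rewrite xpair_eqE (negPf tr).
case: i ri => [|i] ri; first exact/bag_full.
left; split=> // -[[tZ _ _ _ _] _] /=.
by case: (@top_new Z); rewrite tZ.
Qed.

(** A dying label borrows the number of the label that will replace it, since the two never lie in
    the bag together. *)
Let bag_size x : exists f : H -> nat, (forall Z, bag x Z -> f Z < k) /\
  (forall Z Z', bag x Z -> bag x Z' -> f Z = f Z' -> Z = Z').
Proof.
case: x => t i.
exists (fun Z => if `[< beta t Z >] then g t Z else g t (rep t Z)); split.
  move=> Z [[/= bt _]|[[Z' K] _]]; first by rewrite asboolT // g_lt.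
  rewrite asboolF; last by case: K.
  by have [/kid_beta/g_lt] := repP K.
have mixed Z P : bag (t, i) Z -> beta t Z -> bag (t, i) P -> ~ beta t P ->
    g t Z <> g t (rep t P).
  move=> bZ tZ [[] //|[[Z' K] /= iP]] _.
  have [K2 R2] := repP K; move=> /(g_inj tZ (kid_beta K2)) ZP.
  case: bZ => [[_ /=]|[[Z1 [_ _ _ _ nt]]]] //.
  by rewrite ZP => /(_ R2); have [_ _ -> _ _] := K2; rewrite ltnNge iP.
move=> Z Z' bZ bZ'; case: asboolP => tZ; case: asboolP => tZ'.
- exact: g_inj.
- by move/(mixed Z Z' bZ tZ bZ' tZ').
- by move/esym/(mixed Z' Z bZ' tZ' bZ tZ).
case: bZ => [[] //|[[Z1 K] _]]; case: bZ' => [[] //|[[Z1' K'] _]].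
have [{}K _] := repP K; have [{}K' _] := repP K'.
move/(g_inj (kid_beta K) (kid_beta K')) => E.
by have [_ _ <- _ _] := K; have [_ _ <- _ _] := K'; rewrite E.
Qed.

(** As [g (par t)] is injective on its bag, only one label is exchanged at each index. *)
Let bag_swap t P Z : kid t P Z -> rep t P = Z ->
  bag (t, g (par t) P) `\` bag (t, (g (par t) P).+1) = [set P] /\
  bag (t, (g (par t) P).+1) `\` bag (t, g (par t) P) = [set Z].
Proof.
move=> K rPZ; have [tZ tr prZ bP nP] := K.
split; apply/seteqP; split=> W /=.
- move=> [[[/= bW rW]|[[Z' K'] /= gW]] nW].
    by case: nW; left; split=> //= /rW /ltnW.
  have [_ _ _ bW _] := K'.
  apply: g_inj bW bP _; apply/eqP; rewrite eqn_leq gW andbT leqNgt.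
  by apply: contra_notN nW => gW'; right; split=> //; exists Z'.
- move=> ->; split; first by right; split=> //; exists Z.
  by move=> [[]//|[_ /=]]; rewrite ltnn.
- move=> [[[/= bW rW]|[[Z' K'] /= gW]] nW]; last first.
    by case: nW; right; split; [exists Z'|exact: ltnW].
  have [RW|nRW] := pselect (isrep t W); last by case: nW; left; split.
  have [[_ _ _ bpW _] repW] := RW.
  have EP : pr W = P.
    apply: g_inj bpW bP _; apply/eqP; rewrite eqn_leq -ltnS (rW RW) leqNgt.
    by apply: contra_notN nW => gW'; left.
  by rewrite -rPZ -EP repW.
- move=> ->; have RZ : isrep t Z by split; rewrite prZ.
  split; first by left; split; [exact: kid_beta K|rewrite /= prZ].
  move=> [[_ /= /(_ RZ)]|[[Z' [_ _ _ _ nb]]] _]; first by rewrite prZ ltnn.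
  exact/nb/(kid_beta K).
Qed.

Lemma refined_pseudo_tree_decomposition :
  exists (T2 : sgraph) (B2 : T2 -> set H), pseudo_tree_decomposition B2 /\
    forall t, exists f : H -> nat, (forall Z, B2 t Z -> f Z < k) /\
      (forall Z Z', B2 t Z -> B2 t Z' -> f Z = f Z' -> Z = Z').
Proof.
have treeT' := rooted_is_tree rT'.
exists T', bag; split; last exact: bag_size.
have bagk t Z : beta t Z -> bag (t, k) Z by move/bag_full.
(* If [P] survives, both ends lie in the bag of [(t, k)]; if [Z] is the representative of [P], the
   exchange gives a pseudo-edge; otherwise both lie in the bag of [(t, 0)]. *)
have E2 Z P : top Z != root -> beta (par (top Z)) P -> pr Z = P ->
    (exists t : T', bag t Z /\ bag t P) \/
    exists s t : T', [/\ adj s t, bag s `\` bag t = [set P] & bag t `\` bag s = [set Z]].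
  move=> tr bP prZ; set t := top Z in tr bP *.
  have [tP|ntP] := pselect (beta t P).
    by left; exists (t, k); split; apply: bagk => //; exact: top_beta.
  have K : kid t P Z by [].
  have [rPZ|rPZ] := pselect (rep t P = Z).
    right; exists (t, g (par t) P), (t, (g (par t) P).+1).
    have [-> ->] := bag_swap K rPZ; split=> //.
    rewrite /adj /= /par_adj /par' /=; apply/orP; right.
    by rewrite xpair_eqE andbF eqxx.
  left; exists (t, 0); split; last by right; split=> //; exists Z.
  by left; split; [exact: top_beta|move=> [_]; rewrite prZ].
split=> //.
- by move=> Z; exists (top Z, k); exact/bagk/top_beta.
- move=> Z Z' /adjP[[t [tZ tZ']]|[tr bP prZ]|[tr bP prZ]].
  + by left; exists (t, k); split; exact: bagk.
  + have [[t [? ?]]|[s [t [st ? ?]]]] := E2 _ _ tr bP prZ; first by left; exists t.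
    by right; exists t, s; split; rewrite // adj_sym.
  + have [[t [? ?]]|[s [t [st ? ?]]]] := E2 _ _ tr bP prZ; first by left; exists t.
    by right; exists s, t; split.
- apply: path_convexP => // Z s t Zs Zt.
  have [top' tP] := bag_top Z.
  exact: (chain_of_top rT' tP).
Qed.

End Refinement.

(** * Labels *)

Section Ancestors.
Variables (T : sgraph) (root : T) (par : T -> T) (h : T -> nat).
Hypothesis rT : rooted root par h.

Inductive anc (u : T) : T -> Prop :=
| anc_refl : anc u u
| anc_par t : t != root -> anc u (par t) -> anc u t.

Lemma anc_le u t : anc u t -> h u <= h t.
Proof.
by elim=> // {}t tr _ IH; have [_ _ /(_ _ tr) -> _] := rT; exact: leqW.
Qed.

Lemma anc_trans u v t : anc u v -> anc v t -> anc u t.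
Proof. by move=> uv; elim=> // {}t tr _; exact: anc_par. Qed.

Lemma anc_comparable u v t : anc u t -> anc v t -> h u <= h v -> anc u v.
Proof.
move=> ut vt; elim: vt ut => // {}t tr vt IH ut uv.
case: ut uv tr IH vt => [|{}t _ ut] uv tr IH vt; last exact: IH.
have := anc_le vt; have [_ _ /(_ _ tr) E _] := rT.
by move: uv; rewrite E => /leq_trans H /H; rewrite ltnn.
Qed.

Lemma anc_eq u v : anc u v -> h u = h v -> u = v.
Proof.
case=> // t tr /anc_le; have [_ _ /(_ _ tr) -> _] := rT.
by move=> + E; rewrite E ltnn.
Qed.

End Ancestors.

Section Labels.
Variables (G T : sgraph) (root : T) (par : T -> T) (h : T -> nat).
Hypothesis rT : rooted root par h.
Variables (B : T -> set G) (k r : nat) (f : T -> G -> nat) (top : G -> T).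
Hypothesis f_lt : forall t x, B t x -> f t x < k.
Hypothesis f_near : forall t x y, B t x -> B t y -> f t x = f t y -> dist_le r x y.
Hypothesis top_B : forall v, B (top v) v.
Hypothesis B_top : forall t v, B t v -> t = top v \/ t != root /\ B (par t) v.
Hypothesis B_edge : forall u v, adj u v -> exists t, B t u /\ B t v.

Notation anc := (anc root par).
Notation label := (T * set G)%type.

Let D := 2 * k * r.

Let hp t : t != root -> h t = (h (par t)).+1.
Proof. by have [_ _ + _] := rT; apply. Qed.

Definition cluster (t : T) (x : G) : set G := [set y | chain (B t) (@dist_le G r) x y].

Definition triggered (q : G -> option label) (t : T) (x : G) : Prop :=
  exists2 z, cluster t x z & forall c, q c <> None -> B t c ->
    h (top c) <= h (top z) -> ~ dist_le D c z.

(** A label records where it was created: [Z.1] is its node of birth, and [Z.2] the cluster that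
    received it. *)
Definition relabel (q : G -> option label) (t : T) (x : G) : option label :=
  if `[< B t x >] then if `[< triggered q t x >] then Some (t, cluster t x) else q x
  else None.

(** [n] is fuel: starting from [t], the amount [h t] ends the recursion exactly at the root. *)
Fixpoint labn (n : nat) (t : T) : G -> option label :=
  relabel (if n is m.+1 then labn m (par t) else fun=> None) t.

Definition lab t := labn (h t) t.

Let prev t : G -> option label := if t == root then fun=> None else lab (par t).

Let labE t : lab t = relabel (prev t) t.
Proof.
rewrite /lab /prev; case: eqVneq => [->|tr]; first by have [-> _ _ _] := rT.
by rewrite (hp tr).
Qed.

Let prevE t : t != root -> prev t = lab (par t).
Proof. by rewrite /prev => /negPf ->. Qed.

Let prev_some t x : prev t x <> None -> t != root.
Proof. by rewrite /prev; case: eqVneq. Qed.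

Lemma cluster_refl t x : B t x -> cluster t x x.
Proof. exact: chain0. Qed.

Lemma cluster_sym t x y : cluster t x y -> cluster t y x.
Proof. by apply: chain_sym => ? ?; exact: dist_le_sym. Qed.

Lemma cluster_eq t x y : cluster t x y -> cluster t x = cluster t y.
Proof.
move=> xy; apply/seteqP; split=> z; last exact: chain_trans.
exact/chain_trans/cluster_sym.
Qed.

Lemma cluster_B t x y : cluster t x y -> B t y.
Proof. exact: chain_right. Qed.

Lemma cluster_near t x y : B t x -> B t y -> dist_le r x y -> cluster t x y.
Proof. exact: chain1. Qed.

(** The [k] parts given by [f t] are the tags in [chain_tagged], with steps of length [r]; this is
    where [D] comes from. *)
Lemma cluster_diam t x y : cluster t x y -> dist_le D x y.
Proof.
move=> xy; rewrite /D.
have := @chain_tagged G r nat (fun x j => f t x = j) (iota 0 k) (B t) x y.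
rewrite size_iota; apply=> //.
- by move=> z /f_lt zk; exists (f t z); rewrite ?mem_iota.
- by move=> z w j Bz Bw zj wj; apply: f_near Bz Bw _; rewrite zj wj.
Qed.

Lemma cluster_diam2 t x y z : cluster t x y -> cluster t x z -> dist_le D y z.
Proof. by move=> /cluster_eq E xz; apply: (@cluster_diam t); rewrite -E. Qed.

Let trig_eq q t x y : cluster t x y -> triggered q t x -> triggered q t y.
Proof. by move=> /cluster_eq E [z xz H]; exists z => //; rewrite -E. Qed.

Lemma lab_B t x : lab t x <> None -> B t x.
Proof. by rewrite labE /relabel; case: asboolP. Qed.

Lemma labP t x Z : lab t x = Some Z ->
  [/\ B t x, triggered (prev t) t x & Z = (t, cluster t x)] \/
  [/\ ~ triggered (prev t) t x, t != root & lab (par t) x = Some Z].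
Proof.
rewrite labE /relabel; case: asboolP => // Bx; case: asboolP => [tx [<-]|ntx pZ].
  by left.
have tr : t != root by apply: (@prev_some t x); rewrite pZ.
by right; split=> //; rewrite -(prevE tr).
Qed.

Let lab_trig t x : B t x -> triggered (prev t) t x -> lab t x = Some (t, cluster t x).
Proof. by move=> Bx tx; rewrite labE /relabel !asboolT. Qed.

(** Such vertices lie in one cluster, so they are relabelled together or both inherit. Hence each
    part of a bag carries at most one label. *)
Lemma lab_near t x y Z Z' : lab t x = Some Z -> lab t y = Some Z' ->
  dist_le r x y -> Z = Z'.
Proof.
elim/(rooted_ind rT): t => t IH xZ yZ' xy.
have Bx : B t x by apply: lab_B; rewrite xZ.
have By : B t y by apply: lab_B; rewrite yZ'.
have cxy := cluster_near Bx By xy.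
have [[_ tx ->]|[ntx tr pxZ]] := labP xZ.
  have ty := trig_eq cxy tx; move: yZ'; rewrite (lab_trig By ty) => -[<-].
  by rewrite (cluster_eq cxy).
have [[_ ty _]|[_ _ pyZ]] := labP yZ'; last exact: IH tr pxZ pyZ xy.
by case: ntx; exact: trig_eq (cluster_sym cxy) ty.
Qed.

Lemma lab_origin t x Z : lab t x = Some Z ->
  [/\ anc Z.1 t, lab Z.1 x = Some Z, B Z.1 x, triggered (prev Z.1) Z.1 x &
      Z.2 = cluster Z.1 x].
Proof.
elim/(rooted_ind rT): t => t IH xZ.
have [[Bx tx E]|[_ tr pxZ]] := labP xZ.
  by subst Z; split=> //; exact: anc_refl.
have [aZ ? ? ? ?] := IH tr pxZ; split=> //; exact: anc_par.
Qed.

Lemma lab_mem t x Z : lab t x = Some Z -> Z.2 x.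
Proof. by move=> /lab_origin[_ _ Bx _ ->]; exact: cluster_refl. Qed.

Lemma lab_diam t x Z y z : lab t x = Some Z -> Z.2 y -> Z.2 z -> dist_le D y z.
Proof. by move=> /lab_origin[_ _ _ _ ->]; exact: cluster_diam2. Qed.

Lemma lab_between t u x Z : lab t x = Some Z -> anc u t -> h Z.1 <= h u ->
  lab u x = Some Z.
Proof.
elim/(rooted_ind rT): t => t IH xZ ut Zu.
have [aZ _ _ _ _] := lab_origin xZ.
case: ut xZ IH aZ => [//|{}t tr ut] xZ IH aZ.
have [[_ _ E]|[_ _ pxZ]] := labP xZ; last exact: IH.
move: Zu; rewrite E /= (hp tr) => /leq_trans/(_ (anc_le rT ut)).
by rewrite ltnn.
Qed.

Lemma top_anc t v : B t v -> anc (top v) t.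
Proof.
elim/(rooted_ind rT): t => t IH Bv.
have [->|[tr pv]] := B_top Bv; first exact: anc_refl.
exact: anc_par (IH tr pv).
Qed.

Lemma B_between t u v : B t v -> anc u t -> h (top v) <= h u -> B u v.
Proof.
elim/(rooted_ind rT): t => t IH Bv ut vu.
case: ut Bv IH => [//|{}t tr ut] Bv IH.
have [E|[_ pv]] := B_top Bv; last exact: IH.
move: vu; rewrite -E (hp tr) => /leq_trans/(_ (anc_le rT ut)).
by rewrite ltnn.
Qed.

(** If the cluster of [v] is not triggered, the condition fails for [v] itself and provides [c];
    relabelling may change the label of [c] but does not erase it. *)
Lemma lab_cover t v : B t v -> exists c, [/\ lab t c <> None, dist_le D c v &
  h (top c) <= h (top v)].
Proof.
move=> Bv; have [tv|ntv] := pselect (triggered (prev t) t v).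
  by exists v; split=> //; [rewrite lab_trig|exact: dist_le_refl].
have [|c] := pselect (exists c, [/\ prev t c <> None, B t c,
    h (top c) <= h (top v) & dist_le D c v]).
  move=> [c [pc Bc cv dc]]; exists c; split=> //.
  by rewrite labE /relabel asboolT //; case: asboolP.
case: ntv; exists v; first exact: cluster_refl.
by move=> d pd Bd dv dd; apply: c; exists d.
Qed.

Lemma lab_persist t u x : B t x -> anc u t -> lab u x <> None -> lab t x <> None.
Proof.
move=> Bx ut ux; have hx : h (top x) <= h u by exact: anc_le (top_anc (lab_B ux)).
elim: ut Bx => // {}t tr ut IH Bx.
have px : B (par t) x.
  apply: (B_between Bx _ _); first exact: anc_par (anc_refl _ _ _).
  exact: leq_trans hx (anc_le rT ut).
rewrite labE /relabel asboolT // prevE //; case: asboolP => // _; exact: IH.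
Qed.

(** * Boundedly many labels along a branch *)

Let trail v t (Z : label) := exists u c,
  [/\ anc (top v) u, anc u t, B (top v) c & lab u c = Some Z].

(* A label met by [B s] between [s] and [t] is either present at [s], or created
   by labelling for the first time a vertex [y] of [B s]. *)
Let tag s t (Z : label) (j : bool * nat) :=
  if j.1 then exists y, [/\ B s y, f s y = j.2, anc s Z.1, anc Z.1 t &
                            prev Z.1 y = None /\ lab Z.1 y = Some Z]
  else exists c, lab s c = Some Z /\ f s c = j.2.

Let tags := [seq (b, j) | b <- [:: true; false], j <- iota 0 k].

Let tags_mem b j : j < k -> (b, j) \in tags.
Proof.
by move=> jk; apply: allpairs_f; [case: b; rewrite !inE|rewrite mem_iota].
Qed.

(** If [Z] is born below [s], let [z] be the vertex that triggered it. If [z] already belongs to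
    [B s], it had no label, as it would have been its own witness. Otherwise [c] is older than [z]
    and within [D] of it, so [c] had no label. *)
Let trail_tag v t Z : trail v t Z -> exists2 j, j \in tags & tag (top v) t Z j.
Proof.
move=> [u [c [su ut sc uc]]]; set s := top v in su sc *.
have [aZ Zc BZ [z cz Hz] E2] := lab_origin uc.
have [Zs|sZ] := leqP (h Z.1) (h s).
  exists (false, f s c); first exact: tags_mem (f_lt sc).
  by exists c; split=> //; exact: lab_between uc su Zs.
have asZ : anc s Z.1 by apply: (anc_comparable rT su aZ); exact: ltnW.
have trZ : triggered (prev Z.1) Z.1 c by exists z.
have lab_in y : cluster Z.1 c y -> lab Z.1 y = Some Z.
  move=> cy; rewrite lab_trig; last exact: trig_eq cy trZ.
    by rewrite -(cluster_eq cy) -E2; case: (Z).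
  exact: cluster_B cy.
have [y [cy By py]] : exists y, [/\ cluster Z.1 c y, B s y & prev Z.1 y = None].
  have [zs|sz] := leqP (h (top z)) (h s).
    exists z; split=> //; first exact: B_between (cluster_B cz) asZ zs.
    have [//|/Hz] := pselect (prev Z.1 z = None).
    move=> /(_ (cluster_B cz) (leqnn _)); case; exact: dist_le_refl.
  exists c; split=> //; first exact: cluster_refl.
  have [//|/Hz] := pselect (prev Z.1 c = None).
  move=> /(_ BZ); case; last exact: cluster_diam cz.
  by apply: leq_trans (ltnW sz); exact/(anc_le rT)/top_anc.
exists (true, f s y); first exact: tags_mem (f_lt By).
by exists y; split=> //; [exact: anc_trans aZ ut|split=> //; exact: lab_in].
Qed.

(** If [Z] is born strictly first, then [y'], being within [r] of [y], receives [Z] too and stays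
    labelled, so it cannot be unlabelled just before the birth of [Z']. *)
Let tag_inj_lt s t Z Z' j : tag s t Z (true, j) -> tag s t Z' (true, j) ->
  h Z.1 <= h Z'.1 -> Z = Z'.
Proof.
move=> [y [/= Bsy fy asZ aZt [py yZ]]] [y' [/= Bsy' fy' asZ' aZt' [py' yZ']]] ZZ'.
have yy' : dist_le r y y' by apply: f_near Bsy Bsy' _; rewrite fy fy'.
have aZZ' := anc_comparable rT aZt aZt' ZZ'.
have [E|NE] := eqVneq (h Z.1) (h Z'.1).
  have E1 := anc_eq rT aZZ' E; move: yZ'; rewrite -E1 => yZ'.
  exact: lab_near yZ yZ' yy'.
have BZ'y' : B Z'.1 y' by apply: lab_B; rewrite yZ'.
have hy' : h (top y') <= h s by exact/(anc_le rT)/top_anc.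
have BZy' : B Z.1 y'.
  by apply: B_between BZ'y' aZZ' _; exact: leq_trans hy' (anc_le rT asZ).
have [_ _ BZy trZ _] := lab_origin yZ.
have y'Z : lab Z.1 y' <> None.
  by rewrite lab_trig //; apply: trig_eq trZ; exact: cluster_near.
case: aZZ' NE py' BZ'y' {yZ' aZt' asZ' ZZ'} => [|t' tr aZ] NE; first by rewrite eqxx in NE.
rewrite prevE // => py' By'; case: (lab_persist _ aZ y'Z py').
apply: B_between By' (anc_par tr (anc_refl _ _ _)) _.
by apply: leq_trans hy' _; apply: leq_trans (anc_le rT asZ) (anc_le rT aZ).
Qed.

Let tag_inj s t Z Z' j : tag s t Z j -> tag s t Z' j -> Z = Z'.
Proof.
case: j => [[] j].
  move=> tZ tZ'; have [ZZ'|/ltnW Z'Z] := leqP (h Z.1) (h Z'.1).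
    exact: tag_inj_lt tZ tZ' ZZ'.
  exact/esym/(tag_inj_lt tZ' tZ Z'Z).
move=> [c [cZ /= fc]] [c' [cZ' /= fc']].
have cs : B s c by apply: lab_B; rewrite cZ.
have cs' : B s c' by apply: lab_B; rewrite cZ'.
by apply: lab_near cZ cZ' _; apply: f_near cs cs' _; rewrite fc fc'.
Qed.

(** * The graph of labels *)

(** By [lab_origin], testing at the node of birth loses no label. *)
Definition is_label (Z : label) : bool := `[< exists x, lab Z.1 x = Some Z >].

Definition label_vertex := {Z : label | is_label Z}.

(** The bound covers [2 * D + 1], needed across an edge of [G], and [5 * D], needed between a parent
    label and another label of the parent bag in [seen_chain]. *)
Let near (Z Z' : label) := exists t c c',
  [/\ lab t c = Some Z, lab t c' = Some Z' & dist_le (5 * D + 1) c c'].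

(** The bound [2 * D] allows a detour through a vertex within [D] of both [c] and [x]. *)
Let pcand (N P : label) := N.1 != root /\
  exists c x, [/\ lab (par N.1) c = Some P, N.2 x & dist_le (2 * D) c x].

(* One parent suffices: the other candidates are near it, hence adjacent to it. *)
Let pr (N : label_vertex) : label_vertex :=
  xget N [set P : label_vertex | pcand (val N) (val P)].

Let ladj_prop (Z Z' : label_vertex) := [\/ near (val Z) (val Z'),
  pcand (val Z) (val Z') /\ pr Z = Z' | pcand (val Z') (val Z) /\ pr Z' = Z].

Let ladj : rel label_vertex := fun Z Z' => (Z != Z') && `[< ladj_prop Z Z' >].

Let ladj_sym : symmetric ladj.
Proof.
move=> Z Z'; rewrite /ladj eq_sym; congr (_ && _).
apply/asboolP/asboolP => -[[t [c [c' [? ? ?]]]]|?|?].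
- by apply: Or31; exists t, c', c; split=> //; exact: dist_le_sym.
- exact: Or33.
- exact: Or32.
- by apply: Or31; exists t, c', c; split=> //; exact: dist_le_sym.
- exact: Or33.
- exact: Or32.
Qed.

Let ladj_irr : irreflexive ladj.
Proof. by move=> Z; rewrite /ladj eqxx. Qed.

Definition label_graph : sgraph := SGraph ladj_sym ladj_irr.

Let ladj_within (Z Z' : label_graph) : ladj_prop Z Z' -> dist_le 1 Z Z'.
Proof.
move=> ZZ'; have [->|NE] := eqVneq Z Z'; first exact: dist_le_refl.
by apply: dist_le_adj; rewrite /adj /= /ladj NE; exact/asboolP.
Qed.

Let lab_vertex t x Z : lab t x = Some Z -> exists V : label_graph, val V = Z.
Proof.
move=> xZ; have PZ : is_label Z by apply/asboolP; exists x; have [] := lab_origin xZ.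
by exists (exist _ Z PZ).
Qed.

Let rep_exists v : exists Z : label_graph, exists c,
  [/\ lab (top v) c = Some (val Z), dist_le D c v & h (top c) <= h (top v)].
Proof.
have [c [lc dc hc]] := lab_cover (top_B v).
case E : (lab (top v) c) lc => [Z|] // _.
by have [V VZ] := lab_vertex E; exists V, c; rewrite VZ.
Qed.

Lemma label_map : exists phi : G -> label_graph, forall v, exists c,
  [/\ lab (top v) c = Some (val (phi v)), dist_le D c v & h (top c) <= h (top v)].
Proof. by have [phi phiP] := choice rep_exists; exists phi. Qed.

(** * The map to the label graph is a quasi-isometry *)

Section LabelMap.
Variable phi : G -> label_graph.
Hypothesis phiP : forall v, exists c,
  [/\ lab (top v) c = Some (val (phi v)), dist_le D c v & h (top c) <= h (top v)].

(** Climb from [t] to [top v]. While [Z] is inherited, keep [c]. At the birth of [Z], switch to a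
    label [V0] seen near [v] in the parent bag; [pr Z] links it to [Z] in two steps. *)
Let seen_chain t v c (Z : label_graph) : B t v -> lab t c = Some (val Z) -> dist_le D c v ->
  h (top c) <= h (top v) ->
  chain (fun V : label_graph => trail v t (val V)) (@dist_le label_graph 2) (phi v) Z.
Proof.
elim/(rooted_ind rT): t c Z => t IH c Z Bv cZ dc hc.
have Bc : B t c by apply: lab_B; rewrite cZ.
have asc : B (top v) c by exact: B_between Bc (top_anc Bv) hc.
have tZ : trail v t (val Z).
  by exists t, c; split=> //; [exact: top_anc|exact: anc_refl].
have [E|[tr pv]] := B_top Bv.
  have [c0 [c0Z d0 h0]] := phiP v.
  apply: chain1 => //.
    exists t, c0; split; [exact: top_anc|exact: anc_refl| |by rewrite E].
    by apply: lab_B; rewrite c0Z.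
  apply: (@dist_le_le _ _ _ 1) => //; apply: ladj_within; apply: Or31.
  exists t, c0, c; split=> //; first by rewrite E.
  by apply: dist_le_le (dist_le_trans d0 (dist_le_sym dc)); lia.
have trail_par V : trail v (par t) V -> trail v t V.
  by move=> [u [d [? ? ? ?]]]; exists u, d; split=> //; exact: anc_par.
have [[_ trg EZ]|[_ _ pcZ]] := labP cZ; last first.
  have pc : B (par t) c by apply: lab_B; rewrite pcZ.
  by apply: chain_sub (IH tr c Z pv pcZ dc hc) => V; exact: trail_par.
have [c0 [lc0 d0 h0]] := lab_cover pv.
case E0 : (lab (par t) c0) lc0 => [Z0|] // _.
have [V0 V0E] := lab_vertex E0; rewrite -V0E in E0.
have C0 := IH tr c0 V0 pv E0 d0 h0.
have C0' : chain (fun V : label_graph => trail v t (val V)) (@dist_le label_graph 2) (phi v) V0.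
  by apply: chain_sub C0 => V; exact: trail_par.
apply: chain_trans C0' (chain1 (chain_right C0') tZ _).
have Z1 : (val Z).1 = t by rewrite EZ.
have Zc : (val Z).2 c by exact: lab_mem cZ.
have cand : exists P : label_vertex, pcand (val Z) (val P).
  exists V0; split; rewrite Z1 //; exists c0, c; split=> //.
  by apply: dist_le_le (dist_le_trans d0 (dist_le_sym dc)); lia.
have := xgetPex Z cand; rewrite -/(pr Z) /= => prZ.
have E1 : dist_le 1 (pr Z : label_graph) Z by apply: ladj_within; apply: Or33.
apply: (dist_le_trans (m := 1) (n := 1)) E1.
apply: ladj_within; apply: Or31.
have [_ [c1 [x [c1P Zx d1]]]] := prZ; rewrite Z1 in c1P.
exists (par t), c0, c1; split=> //.
have dxc := lab_diam cZ Zc Zx.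
(* The route is [c0], [v], [c], [x], [c1], of lengths [D], [D], [D] and [2 * D]. *)
have d01 := dist_le_trans (dist_le_trans (dist_le_trans d0 (dist_le_sym dc)) dxc) (dist_le_sym d1).
by apply: dist_le_le d01; lia.
Qed.

(** The chain has steps of length [2] and uses [2 * k] tags, each held by a single label, so
    [chain_tagged] gives [2 * (2 * k) * 2]. *)
Let seen_within t v c (Z : label_graph) : B t v -> lab t c = Some (val Z) ->
  dist_le D c v -> h (top c) <= h (top v) -> dist_le (8 * k) (phi v) Z.
Proof.
move=> Bv cZ dc hc.
have := chain_tagged (tag := fun V : label_graph => tag (top v) t (val V)) (js := tags)
  _ _ (seen_chain Bv cZ dc hc).
rewrite size_allpairs size_iota /= => H; apply: dist_le_le (H _ _); first by lia.
- by move=> V /trail_tag.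
- by move=> V V' j _ _ tV tV'; rewrite (val_inj (tag_inj tV tV')); exact: dist_le_refl.
Qed.

(** In a bag containing both ends of an edge, the labels near them are equal or adjacent;
    [seen_within] costs [8 * k] at each end. *)
Lemma label_map_lipschitz n u v :
  dist_le n u v -> dist_le (n * (16 * k + 1)) (phi u) (phi v).
Proof.
apply: dist_le_ind => {}u {}v uv; have [t [Bu Bv]] := B_edge uv.
have [c [lc dc hc]] := lab_cover Bu; have [d [ld dd hd]] := lab_cover Bv.
case Ec : (lab t c) lc => [Z|] // _; case Ed : (lab t d) ld => [W|] // _.
have [VZ EZ] := lab_vertex Ec; have [VW EW] := lab_vertex Ed; subst Z W.
have uZ := seen_within Bu Ec dc hc; have vW := seen_within Bv Ed dd hd.
have ZW : dist_le 1 VZ VW.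
  have [->|NE] := eqVneq VZ VW; first exact: dist_le_refl.
  apply: ladj_within; apply: Or31; exists t, c, d; split=> //.
  have cd := dist_le_trans (dist_le_trans dc (dist_le_adj uv)) (dist_le_sym dd).
  by apply: dist_le_le cd; lia.
by apply: dist_le_le (dist_le_trans (dist_le_trans uZ ZW) (dist_le_sym vW)); lia.
Qed.

(** The [near] case is the worst: [5 * D + 1], plus the diameter [D] of each of the two clusters. *)
Let ladj_diam (Z Z' : label_graph) x y : ladj Z Z' -> (val Z).2 x -> (val Z').2 y ->
  dist_le (7 * D + 1) x y.
Proof.
have cand_diam N P a b : is_label N -> pcand N P -> N.2 a -> P.2 b -> dist_le (7 * D + 1) a b.
  move=> /asboolP[e eN] [_ [c [w [cP Nw cw]]]] Na Pb.
  have aw := lab_diam eN Na Nw; have cb := lab_diam cP (lab_mem cP) Pb.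
  by apply: dist_le_le (dist_le_trans (dist_le_trans aw (dist_le_sym cw)) cb); lia.
move=> /andP[_ /asboolP[[t [c [d [cZ dZ cd]]]]|[ZZ' _]|[ZZ' _]]] Zx Zy.
- have xc := lab_diam cZ Zx (lab_mem cZ); have dy := lab_diam dZ (lab_mem dZ) Zy.
  by apply: dist_le_le (dist_le_trans (dist_le_trans xc cd) dy); lia.
- exact: cand_diam (valP Z) ZZ' Zx Zy.
- exact/dist_le_sym/(cand_diam _ _ _ _ (valP Z') ZZ' Zy Zx).
Qed.

(** Of the additive [3 * D], two [D] lead from [u] and [v] to labelled vertices, and one crosses the
    last cluster. *)
Lemma label_map_expansive n u v :
  dist_le n (phi u) (phi v) -> dist_le (n * (7 * D + 1) + 3 * D) u v.
Proof.
move=> [p [pp lp sp]].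
have main (Z : label_graph) q x y : path (@adj label_graph) Z q -> (val Z).2 x ->
    (val (last Z q)).2 y -> dist_le (size q * (7 * D + 1) + D) x y.
  elim: q Z x => [|W q IH] Z x /=.
    move=> _ Zx Zy; have /asboolP[e eZ] := valP Z.
    exact: lab_diam eZ Zx Zy.
  move=> /andP[ZW Wq] Zx ly; have /asboolP[w wW] := valP W.
  have xw := ladj_diam ZW Zx (lab_mem wW).
  by apply: dist_le_le (dist_le_trans xw (IH W w Wq (lab_mem wW) ly)); rewrite mulSn addnA.
have [c [cu dc _]] := phiP u; have [d [dv dd _]] := phiP v.
have cd : dist_le (size p * (7 * D + 1) + D) c d.
  by apply: main pp (lab_mem cu) _; rewrite lp; exact: lab_mem dv.
apply: dist_le_le (dist_le_trans (dist_le_trans (dist_le_sym dc) cd) dd).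
have : size p * (7 * D + 1) <= n * (7 * D + 1) by rewrite leq_mul2r sp orbT.
by lia.
Qed.

(** Any vertex that carries [Z] at its birth will do, as its own labelled vertex. *)
Lemma label_map_dense Z : exists v, dist_le (8 * k) (phi v) Z.
Proof.
have /asboolP[x xZ] := valP Z; exists x.
have Bx : B (val Z).1 x by apply: lab_B; rewrite xZ.
exact: seen_within Bx xZ (dist_le_refl _ _) (leqnn _).
Qed.

End LabelMap.

(** A label is numbered by the part of some vertex carrying it, injectively by [lab_near]; its top
    is its node of birth. *)
Lemma label_graph_decomposition :
  exists (T2 : sgraph) (B2 : T2 -> set label_graph), pseudo_tree_decomposition B2 /\
    forall t, exists f : label_graph -> nat, (forall Z, B2 t Z -> f Z < k) /\
      (forall Z Z', B2 t Z -> B2 t Z' -> f Z = f Z' -> Z = Z').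
Proof.
pose beta t (Z : label_graph) := exists x, lab t x = Some (val Z).
have /choice[g gP] : forall tZ : T * label_graph, exists j, beta tZ.1 tZ.2 ->
    exists x, lab tZ.1 x = Some (val tZ.2) /\ f tZ.1 x = j.
  move=> [t Z] /=; have [[x xZ]|nb] := pselect (beta t Z).
    by exists (f t x) => _; exists x.
  by exists 0.
have beta_top Z : beta (val Z).1 Z by have /asboolP := valP Z.
apply: (@refined_pseudo_tree_decomposition T root par h rT label_graph k beta
  (fun t Z => g (t, Z)) (fun Z => (val Z).1) pr) => //.
- move=> t Z /(gP (t, Z))[x [/= xZ <-]]; apply: f_lt; apply: lab_B.
  by rewrite xZ.
- move=> t Z Z' /(gP (t, Z))[x [/= xZ <-]] /(gP (t, Z'))[y [/= yZ <-]] xy.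
  apply: val_inj; apply: lab_near (xZ) (yZ) _; apply: f_near (xy); apply: lab_B.
    by rewrite xZ.
  by rewrite yZ.
- move=> t Z [x xZ]; have [[_ _ ->]|[_ tr pZ]] := labP xZ; first by left.
  by right; split=> //; exists x.
- move=> Z /[dup] tr /hp E [x xZ].
  have [/(anc_le rT) + _ _ _ _] := lab_origin xZ.
  by rewrite E ltnn.
- move=> Z Z' /andP[_ /asboolP].
  move=> [[t [c [d [cZ dZ _]]]]|[[tr [c [_ [cP _ _]]]] prZ]|[[tr [c [_ [cP _ _]]]] prZ]].
  + by apply: Or31; exists t; split; [exists c|exists d].
  + by apply: Or32; split=> //; exists c.
  + by apply: Or33; split=> //; exists c.
Qed.

Lemma coarse_quotient : exists (H : sgraph) (phi : G -> H),
  [/\ forall n u v, dist_le n u v -> dist_le (n * (16 * k + 1)) (phi u) (phi v),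
      forall n u v, dist_le n (phi u) (phi v) ->
        dist_le (n * (14 * k * r + 1) + 6 * k * r) u v,
      forall y, exists v, dist_le (8 * k) (phi v) y
    & exists (T2 : sgraph) (B2 : T2 -> set H), pseudo_tree_decomposition B2 /\
        forall t, exists f : H -> nat, (forall Z, B2 t Z -> f Z < k) /\
          (forall Z Z', B2 t Z -> B2 t Z' -> f Z = f Z' -> Z = Z')].
Proof.
have [phi phiP] := label_map; exists label_graph, phi; split.
- by move=> n u v; exact: label_map_lipschitz.
- move=> n u v /(label_map_expansive phiP); apply: dist_le_le.
  by rewrite /D !mulnA.
- exact: label_map_dense.
- exact: label_graph_decomposition.
Qed.

End Labels.

Local Open Scope ring_scope.

Lemma card_le_IP (T : Type) (A : set T) (k : nat) : (A #<= `I_k)%card <->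
  exists f : T -> nat, (forall x, A x -> (f x < k)%N) /\
    (forall x y, A x -> A y -> f x = f y -> x = y).
Proof.
split=> [/pcard_leP[f]|[f [fk fI]]].
  exists f; split=> [x Ax|x y Ax Ay]; first exact: (funS (s := f)).
  by apply: inj; rewrite inE.
have fA : (A #= [set f x | x in A])%card.
  by rewrite card_eq_sym; apply: inj_card_eq => x y /set_mem Ax /set_mem; exact: fI.
have fs : [set f x | x in A] `<=` `I_k by move=> _ [x Ax <-]; exact: fk.
by apply: card_le_trans (subset_card_le fs); move: fA; rewrite card_eq_le => /andP[].
Qed.

(** * Distances and widths over the reals *)

Section Distance.
Variables (R : realType) (G : sgraph).
Implicit Types u v : G.

(** Shortening a walk to a simple path never lengthens it, so the infimum is the least length of a
    walk. *)
Lemma dist_cases u v : (dist R u v = +oo%E /\ forall n, ~ dist_le n u v) \/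
  exists n, [/\ dist R u v = n%:R%:E, dist_le n u v & forall m, dist_le m u v -> (n <= m)%N].
Proof.
have [[n uv]|nuv] := pselect (exists n, dist_le n u v).
  right; have ex : exists n, `[< dist_le n u v >] by exists n; exact/asboolP.
  case: (ex_minnP ex) => {uv}n /asboolP uv nmin.
  exists n; split=> // [|m uvm]; last exact/nmin/asboolP.
  have sn p : is_path u v p -> (n <= size p)%N.
    by move=> [pp lp _]; apply/nmin/asboolP; exists p.
  have [p up pn] := dist_le_simple uv.
  have E : size p = n by apply/eqP; rewrite eqn_leq pn sn.
  apply/eqP; rewrite eq_le; apply/andP; split.
    by apply: ereal_inf_lbound; exists p; rewrite /= ?E.
  by apply: le_ereal_inf_tmp => _ [q /= /sn qn <-]; rewrite lee_fin ler_nat.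
left; split=> [|n uv]; last by apply: nuv; exists n.
rewrite /dist (_ : [set _ | _ in _] = set0) ?ereal_inf0 //.
apply/seteqP; split=> // _ [p /= [pp lp _] _]; apply: nuv.
by exists (size p), p.
Qed.

Lemma dist_leP u v (x : R) : (dist R u v <= x%:E)%E <->
  exists2 n, dist_le n u v & n%:R <= x.
Proof.
have [[-> nuv]|[n [-> uv nmin]]] := dist_cases u v.
  by split=> [|[n /nuv //]]; rewrite leye_eq.
rewrite lee_fin; split=> [nx|[m uvm mx]]; first by exists n.
by apply: le_trans mx; rewrite ler_nat nmin.
Qed.

Lemma dist_fin u v : (dist R u v < +oo)%E ->
  exists n, [/\ dist R u v = n%:R%:E, dist_le n u v & forall m, dist_le m u v -> (n <= m)%N].
Proof. by case: (dist_cases u v) => [[-> _]|//]; rewrite ltxx. Qed.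

Lemma dist_le_nat u v n : dist_le n u v -> (dist R u v <= n%:R%:E)%E.
Proof. by move=> uv; apply/dist_leP; exists n. Qed.

Lemma diam_le (X : set G) (d : R) :
  (forall u v, X u -> X v -> (dist R u v <= d%:E)%E) -> (diam R X <= d%:E)%E.
Proof. by move=> H; apply: ge_ereal_sup => _ [u [v [Xu Xv ->]]]; exact: H. Qed.

Lemma le_diam (X : set G) u v : X u -> X v -> (dist R u v <= diam R X)%E.
Proof. by move=> Xu Xv; apply: ereal_sup_ubound; exists u, v. Qed.

(** Each vertex gets the number of one chosen set containing it. Finite distances are integers, so
    [d] may be rounded down. *)
Lemma union_of_bounded_tags (k : nat) (d : R) (X : set G) : 0 <= d ->
  union_of_bounded k d X ->
  exists f : G -> nat, (forall x, X x -> (f x < k)%N) /\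
    (forall x y, X x -> X y -> f x = f y -> dist_le (Num.truncn d) x y).
Proof.
move=> d0 [F [/card_le_IP[g [gk gI]] Fd ->]].
have /choice[c cP] : forall x, exists Y : set G,
    (\bigcup_(Y in F) Y) x -> F Y /\ Y x.
  move=> x; have [[Y FY Yx]|nx] := pselect ((\bigcup_(Y in F) Y) x); last by exists set0.
  by exists Y.
exists (fun x => g (c x)); split=> [x /cP[/gk]//|x y /cP[Fx cx] /cP[Fy cy]].
move=> /(gI _ _ Fx Fy) E; rewrite -E in cy.
have /dist_leP[n xy nd] := le_trans (le_diam cx cy) (Fd _ Fx).
by apply: dist_le_le xy; rewrite truncn_ge_nat.
Qed.

Lemma counting_le (k : nat) (X : set G) :
  (counting X <= k%:R%:E :> \bar R)%E <-> (X #<= `I_k)%card.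
Proof.
rewrite /counting; case: asboolP => [fX|nfX].
  rewrite lee_fin ler_nat; split=> [sk|]; last exact: geq_card_fset_set.
  have XI : (X #= `I_(size (finmap.enum_fset (fset_set X))))%card.
    by rewrite -{1}(fset_setK fX); apply/card_eq_fsetP.
  move: XI; rewrite card_eq_le => /andP[XI _]; apply: card_le_trans XI _.
  by rewrite card_le_II.
split; first by rewrite leye_eq.
by move=> Xk; case: nfX; apply/finite_set_leP; exists k.
Qed.

Lemma pseudo_tree_width_leP (k : nat) : (pseudo_tree_width R G <= k%:R%:E)%E <->
  exists (T : sgraph) (B : T -> set G),
    pseudo_tree_decomposition B /\ forall t, (B t #<= `I_k)%card.
Proof.
split=> [wk|[T [B [pB Bk]]]]; last first.
  have wB : (width R B <= k%:R%:E)%E.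
    by apply: ge_ereal_sup => _ [t _ <-]; exact/counting_le.
  by apply: le_trans wB; apply: ereal_inf_lbound; exists T, B.
(* A decomposition of width below [k.+1] exists by the definition of the infimum, and bag sizes are
   integers. *)
have : (pseudo_tree_width R G < k.+1%:R%:E)%E.
  by apply: le_lt_trans wk _; rewrite lte_fin ltr_nat.
move=> /ereal_inf_lt[_ [T [B [pB ->]]] wB]; exists T, B; split=> // t.
apply/counting_le.
have : (counting (B t) < k.+1%:R%:E :> \bar R)%E.
  by apply: le_lt_trans wB; apply: ereal_sup_ubound; exists t.
rewrite /counting; case: asboolP => // _; by rewrite lte_fin lee_fin ltr_nat ler_nat.
Qed.

End Distance.

(** * From bounded bags to pseudo-tree-width *)

(** Each constant dominates the two bounds of [coarse_quotient] of its kind, multiplicative or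
    additive. *)
Lemma bounded_tree_decomposition_to_ptw (R : realType) (k : nat) (r : R) (G : sgraph) : 0 <= r ->
  has_bounded_tree_decomposition G k r ->
  quasi_isometric_to_ptw_le ((16 * k + 14 * k * Num.truncn r + 1)%:R : R)
    (8 * k + 6 * k * Num.truncn r)%:R G k.
Proof.
move=> r0 [T [B [[treeT covB edgeB convB] bB]]].
have [root [par [h rT]]] := tree_rooted treeT.
have /choice[f fP] : forall t, exists f : G -> nat, (forall x, B t x -> (f x < k)%N) /\
    (forall x y, B t x -> B t y -> f x = f y -> dist_le (Num.truncn r) x y).
  by move=> t; exact: union_of_bounded_tags (bB t).
have /choice[top topP] : forall v, exists top, B top v /\
    forall t, B t v -> t = top \/ t != root /\ B (par t) v.
  move=> v; apply: (top_of_chain rT (S := B^~ v)); first exact: covB.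
  by move=> s t; exact: path_convex_chain.
have f_lt t x : B t x -> (f t x < k)%N by have [+ _] := fP t; apply.
have f_near t x y : B t x -> B t y -> f t x = f t y -> dist_le (Num.truncn r) x y.
  by have [_ +] := fP t; apply.
have top_B v : B (top v) v by have [] := topP v.
have B_top t v : B t v -> t = top v \/ t != root /\ B (par t) v.
  by have [_ +] := topP v; apply.
have [H [phi [lip exp dense [T2 [B2 [pB2 B2k]]]]]] :=
  coarse_quotient rT f_lt f_near top_B B_top edgeB.
exists H, phi; split; last first.
  by apply/pseudo_tree_width_leP; exists T2, B2; split=> // t; apply/card_le_IP.
split=> [u v|u v|y].
- move=> /dist_fin[n [-> /lip/(dist_le_nat R)/le_trans H1 _]]; apply: H1.
  by rewrite -EFinM -EFinD lee_fin -natrM -natrD ler_nat; nia.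
- move=> /dist_fin[n [-> /exp/(dist_le_nat R)/le_trans H1 _]]; apply: H1.
  rewrite -EFinM -EFinD lee_fin -natrM -natrD ler_nat.
  by set m := Num.truncn r; nia.
- have [v vy] := dense y; exists v; apply: le_trans (dist_le_nat R vy) _.
  by rewrite lee_fin ler_nat; lia.
Qed.

(** * From pseudo-tree-width to bounded bags *)

(** The nodes whose bags meet a ball around [y] are connected: follow a walk from [y] inside the
    ball. A pseudo-edge on it costs one edge of [T], both ends of which have bags meeting the
    ball. *)
Lemma dist_le_chain (H T : sgraph) (B : T -> set H) (m : nat) (y h1 h2 : H) (s t : T) :
  pseudo_tree_decomposition B -> dist_le m y h1 -> dist_le m y h2 -> B s h1 -> B t h2 ->
  chain (fun t => exists2 h, B t h & dist_le m y h) (@adj T) s t.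
Proof.
move=> [treeT covB edgeB convB]; set S := (fun t => _).
have bagS h a b : dist_le m y h -> B a h -> B b h -> chain S (@adj T) a b.
  move=> yh Ba Bb; apply: chain_sub (path_convex_chain treeT convB Ba Bb) => c Bc.
  by exists h.
have stepS h h' a b : adj h h' -> dist_le m y h -> dist_le m y h' -> B a h -> B b h' ->
    chain S (@adj T) a b.
  move=> hh' yh yh' Ba Bb; case: (edgeB _ _ hh') => [[c [ch ch']]|[c [d [cd Ec Ed]]]].
    exact: chain_trans (bagS _ _ _ yh Ba ch) (bagS _ _ _ yh' ch' Bb).
  have [ch _] : (B c `\` B d) h by rewrite Ec.
  have [dh' _] : (B d `\` B c) h' by rewrite Ed.
  apply: chain_trans (bagS _ _ _ yh Ba ch) (chainS _ cd (bagS _ _ _ yh' dh' Bb)).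
  by exists h.
have fromy h a b : dist_le m y h -> B a y -> B b h -> chain S (@adj T) a b.
  move=> [p [pp lp sp]]; elim/last_ind: p h b pp lp sp => [|p x IH] h b.
    by move=> _ /= <- _; apply: bagS; exact: dist_le_refl.
  rewrite rcons_path last_rcons size_rcons => /andP[pp px] <- sp Ba Bb.
  have [c Bc] := covB (last y p).
  have yl : dist_le m y (last y p) by exists p; split=> //; exact: ltnW.
  have yx : dist_le m y x.
    by exists (rcons p x); rewrite rcons_path last_rcons size_rcons pp.
  exact: chain_trans (IH _ c pp erefl (ltnW sp) Ba Bc) (stepS _ _ _ _ px yl yx Bc Bb).
move=> y1 y2 s1 t2; have [a Ba] := covB y.
apply: chain_trans (chain_sym _ (fromy _ _ _ y1 Ba s1)) (fromy _ _ _ y2 Ba t2).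
by move=> c d; rewrite adj_sym.
Qed.

Lemma ptw_to_bounded_tree_decomposition (R : realType) (k : nat) (L C : R) (G : sgraph) :
  0 <= L -> 0 <= C -> quasi_isometric_to_ptw_le L C G k ->
  has_bounded_tree_decomposition G k (2 * L * (L + C) + C).
Proof.
move=> L0 C0 [H [phi [[lip exp _] /pseudo_tree_width_leP[T [B [pB Bk]]]]]].
have [treeT covB edgeB convB] := pB.
have LC0 : 0 <= L + C by exact: addr_ge0.
(* Adjacent vertices have images at distance at most [L + C], hence at most [m], so both enter any
   [D t] with [phi u] in [B t]. *)
set m := Num.truncn (L + C).
pose D t : set G := fun v => exists2 y, B t y & dist_le m (phi v) y.
have phi_edge u v : adj u v -> dist_le m (phi u) (phi v).
  move=> /dist_le_adj uv; have := dist_le_nat R uv => d1.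
  have : (dist R (phi u) (phi v) <= (L + C)%:E)%E.
    apply: le_trans (lip _ _ (le_lt_trans d1 (ltry _))) _.
    rewrite EFinD leeD2r // -[leRHS]mule1.
    by apply: lee_wpmul2l d1; rewrite lee_fin.
  by move=> /dist_leP[n nuv nLC]; apply: dist_le_le nuv; rewrite truncn_ge_nat.
exists T, D; split.
  split=> //.
  - by move=> v; have [t Bt] := covB (phi v); exists t, (phi v) => //; exact: dist_le_refl.
  - move=> u v uv; have [t Bt] := covB (phi u); exists t; split; exists (phi u) => //.
      exact: dist_le_refl.
    exact/dist_le_sym/phi_edge.
  - apply: path_convexP => // v s t [y1 s1 d1] [y2 t2 d2].
    exact: dist_le_chain pB d1 d2 s1 t2.
(* One set for each vertex of [B t]. Two members of a set have images within [2 * m], hence are at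
   distance at most [L * (2 * m) + C]. *)
move=> t; exists [set [set v | dist_le m (phi v) y] | y in B t]; split.
- exact: card_le_trans (card_image_le _ _) (Bk t).
- move=> _ [y _ <-]; apply: diam_le => u v /= uy vy.
  have uv := dist_le_trans uy (dist_le_sym vy).
  have d2 := dist_le_nat R uv.
  apply: le_trans (exp _ _ (le_lt_trans d2 (ltry _))) _.
  rewrite EFinD leeD2r //; apply: le_trans (lee_wpmul2l _ d2) _; first by rewrite lee_fin.
  rewrite -EFinM lee_fin (mulrC 2) -mulrA ler_wpM2l // addnn -mul2n natrM.
  by rewrite ler_wpM2l // truncn_le.
- apply/seteqP; split=> v.
    by move=> [y Bty vy]; exists [set v | dist_le m (phi v) y] => //; exists y.
  by move=> [_ [y Bty <-] vy]; exists y.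
Qed.

Theorem mainTheorem3 (R : realType) :
  (forall (k : nat) (r : R), 0 <= r ->
     exists L C : R, [/\ 0 <= L, 0 <= C &
       forall G : sgraph,
         has_bounded_tree_decomposition G k r ->
         quasi_isometric_to_ptw_le L C G k])
  /\
  (forall (k : nat) (L C : R), 1 <= L -> 1 <= C ->
     forall G : sgraph,
       quasi_isometric_to_ptw_le L C G k ->
       has_bounded_tree_decomposition G k (2 * L * (L + C) + C)).
Proof.
split=> [k r r0|k L C L1 C1 G]; last first.
  by apply: ptw_to_bounded_tree_decomposition; exact: le_trans ler01 _.
exists (16 * k + 14 * k * Num.truncn r + 1)%:R, (8 * k + 6 * k * Num.truncn r)%:R.
by split=> // G; exact: bounded_tree_decomposition_to_ptw.
Qed.
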